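(* Let $f$ be a gauge function such that $x^{-1}f(x)$ is monotonically decreasing on $(0,\infty)$, and let $0\leq s<1$. Then the following are equivalent: (1) $H^f(\mathcal{D}_s)>0$; (2) $H^f(\mathcal{D}_{\leq s})>0$; (3) for every $r\in(s,1]$, it is not the case that $f(x)\leq^* x^r$.
   Context: $2^\omega$ is Cantor space of infinite binary sequences, $2^{<\omega}$ the set of finite binary strings; for $\sigma\in2^{<\omega}$, $[\sigma]=\{x\in2^\omega:\sigma\subseteq x\}$ and $|\sigma|$ is the length of $\sigma$. A gauge function is a continuous non-decreasing $f:\mathbb{R}^+\to\mathbb{R}^+$ with $\lim_{x\to0^+}f(x)=0$. For $A\subseteq2^\omega$, $H^f(A)=\lim_{n\to\infty}\inf\{\sum_i f(2^{-|\sigma_i|}):\bigcup_i[\sigma_i]\supseteq A,\ \forall i\ |\sigma_i|\geq n\}$. For $f,g:\mathbb{R}^+\to\mathbb{R}^+$, $f(x)\leq^* g(x)$ means there is $\delta>0$ with $f(x)\leq g(x)$ for all $x\in(0,\delta)$. $K(\sigma)$ denotes the prefix-free Kolmogorov complexity of $\sigma$ (with respect to a fixed optimal prefix-free machine), and the effective dimension of $x\in2^\omega$ is $dim(x)=\liminf_{n\to\infty}K(x\upharpoonright n)/n$. For $0\le s\le1$, $\mathcal{D}_s=\{x\in2^\omega:dim(x)=s\}$ and $\mathcal{D}_{\leq s}=\{x\in2^\omega:dim(x)\leq s\}$. *)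

(* Defs.v *)
From HB Require Import structures.
From mathcomp Require Import all_boot all_order all_algebra.
From mathcomp Require Import all_classical all_reals all_analysis.
Set Implicit Arguments. Unset Strict Implicit. Unset Printing Implicit Defensive.
Import Order.TTheory GRing.Theory Num.Theory.
Import numFieldNormedType.Exports.
Local Open Scope classical_set_scope.
Local Open Scope ring_scope.

(* A model of computation: partial recursive functions nat -> nat      *)
(* (Kleene/Robinson basis with Cantor pairing).                        *)

Definition cpair (a b : nat) : nat := ((a + b) * (a + b).+1) %/ 2 + b.

Inductive pcode : Type :=
  | CZero | CSucc | CFst | CSnd
  | CPair of pcode & pcode
  | CComp of pcode & pcode
  | CPrec of pcode & pcode
  | CMu of pcode.

Inductive eval : pcode -> nat -> nat -> Prop :=
  | ev_zero x : eval CZero x 0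
  | ev_succ x : eval CSucc x x.+1
  | ev_fst a b : eval CFst (cpair a b) a
  | ev_snd a b : eval CSnd (cpair a b) b
  | ev_pair f g x a b : eval f x a -> eval g x b -> eval (CPair f g) x (cpair a b)
  | ev_comp f g x y z : eval g x y -> eval f y z -> eval (CComp f g) x z
  | ev_prec0 f g x y : eval f x y -> eval (CPrec f g) (cpair x 0) y
  | ev_precS f g x n y z : eval (CPrec f g) (cpair x n) y ->
      eval g (cpair x (cpair n y)) z -> eval (CPrec f g) (cpair x n.+1) z
  | ev_mu f x n : eval f (cpair x n) 0 ->
      (forall m, (m < n)%N -> exists k, eval f (cpair x m) k.+1) ->
      eval (CMu f) x n.

(* bijective coding of binary strings by natural numbers *)
Fixpoint enc (s : seq bool) : nat :=
  match s with
  | [::] => 0%N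
  | b :: s' => ((enc s').*2 + 1 + b)%N
  end.

Definition runs (e : pcode) (tau sigma : seq bool) : Prop :=
  eval e (enc tau) (enc sigma).

Definition halts (e : pcode) (tau : seq bool) : Prop := exists sigma, runs e tau sigma.

Definition prefix_free_machine (e : pcode) : Prop :=
  forall tau tau', halts e tau -> halts e tau' -> prefix tau tau' -> tau = tau'.

Definition optimal_pf_machine (U : pcode) : Prop :=
  prefix_free_machine U /\
  forall M, prefix_free_machine M -> exists c : nat,
    forall tau sigma, runs M tau sigma ->
      exists tau', runs U tau' sigma /\ (size tau' <= size tau + c)%N.

Definition KC {R : realType} (U : pcode) (sigma : seq bool) : \bar R :=
  ereal_inf [set ((size tau)%:R)%:E | tau in [set tau | runs U tau sigma]].

Definition cantor := nat -> bool.

Definition restr (x : cantor) (n : nat) : seq bool := mkseq x n.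

Definition cyl (sigma : seq bool) : set cantor :=
  [set x | forall i, (i < size sigma)%N -> x i = nth false sigma i].

Definition eff_dim {R : realType} (U : pcode) (x : cantor) : \bar R :=
  limn_einf (fun n => (@KC R U (restr x n) * ((n%:R : R)^-1)%:E)%E).

Definition Dim_eq {R : realType} (U : pcode) (s : R) : set cantor :=
  [set x | eff_dim U x = s%:E].
Definition Dim_le {R : realType} (U : pcode) (s : R) : set cantor :=
  [set x | (eff_dim U x <= s%:E)%E].

Definition gauge {R : realType} (f : R -> R) : Prop :=
  {within `]0, +oo[, continuous f} /\
  {in `]0, +oo[ &, {homo f : x y / x <= y}} /\
  (forall x, 0 < x -> 0 < f x) /\
  f x @[x --> 0^'+] --> 0.

(* a countable (possibly finite, via None) family of strings of length >= n
   covering A *)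
Definition covers (A : set cantor) (n : nat) : set (nat -> option (seq bool)) :=
  [set sig | (forall i t, sig i = Some t -> (n <= size t)%N) /\
             A `<=` \bigcup_i (match sig i with Some t => cyl t | None => set0 end)].

Definition cover_cost {R : realType} (f : R -> R) (sig : nat -> option (seq bool))
  : \bar R :=
  (\sum_(i <oo) (match sig i with Some t => (f (2%:R ^- size t))%:E | None => 0 end))%E.

(* H^f(A) = lim_n inf {cost of covers by strings of length >= n};
   the inner infimum is nondecreasing in n, so the limit is the supremum *)
Definition hausdorff {R : realType} (f : R -> R) (A : set cantor) : \bar R :=
  ereal_sup [set ereal_inf [set cover_cost f sig | sig in covers A n] | n in [set: nat]].

Definition ev_le {R : realType} (f g : R -> R) : Prop :=
  exists2 d : R, 0 < d & forall x, 0 < x < d -> f x <= g x.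

(* Main.v *)
Require Import Defs.
From HB Require Import structures.
From mathcomp Require Import all_boot all_order all_algebra.
From mathcomp Require Import all_classical all_reals all_analysis.
From mathcomp Require Import zify ring lra.
Import Order.TTheory GRing.Theory Num.Theory.
Import Defs.

(* If [f <=* x^r] with [s < q < r], the outputs of programs [p] with
   [|p| <= q |sigma|] cover [D_{<= s}] infinitely often, and by Kraft's
   inequality their [f]-cost is small.

   Conversely, let [G n] be the least exponent with [2^-(G n) <= f (2^-n)] and
   [s n <= G n]. Monotonicity of [f] and of [f x / x] makes the increments of
   [G] be 0 or 1, and the hypothesis gives [G n <= (s + o(1)) n] along a sparse
   sequence of squares [n_k]. The function
   [F n = min_k (G (n_k) + max(n - n_k, 0))] dominates [G], agrees with it at
   each [n_k], and has increments 0 or 1. Spread mass uniformly over the sequences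
   vanishing at the positions where [F] does not increase: a cylinder of length
   [n] has mass at most [2^-(F n) <= f (2^-n)], so a cover of small [f]-cost
   misses some [x] of this kind, even after discarding the strings [sigma] with
   [K sigma <= F |sigma| - c], whose total mass is small by Kraft's inequality.
   Such an [x] has dimension at least [s] because [s n <= G n <= F n], and at
   most [s] because [x] restricted to [n_k] is a string of length
   [n_(k-1) + G (n_k) = (s + o(1)) n_k] padded with zeros. *)

(** * Partial recursive functions *)

Lemma half_mulnSr (n : nat) : (n.+1 * n.+2) %/ 2 = (n * n.+1) %/ 2 + n.+1.
Proof.
have -> : n.+1 * n.+2 = n.+1 * 2 + n * n.+1 by nia.
by rewrite divnMDl // addnC.
Qed.

Lemma half_mulnS_mono (m n : nat) : m <= n -> (m * m.+1) %/ 2 <= (n * n.+1) %/ 2.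
Proof. by move=> mn; apply: leq_div2r; apply: leq_mul. Qed.

Lemma cpair_lt (a b a' b' : nat) : a + b < a' + b' -> cpair a b < cpair a' b'.
Proof.
move=> /half_mulnS_mono; rewrite half_mulnSr /cpair; lia.
Qed.

Lemma cpair_inj (a b a' b' : nat) : cpair a b = cpair a' b' -> a = a' /\ b = b'.
Proof.
move=> E; have S : a + b = a' + b'.
  case: (ltngtP (a + b) (a' + b')) => // /cpair_lt; lia.
by move: E; rewrite /cpair S; lia.
Qed.

(** Inverts [cpair] by walking along the antidiagonals: one step goes from [(a + 1, b)] to
    [(a, b + 1)], and from [(0, b)] to the start [(b + 1, 0)] of the next antidiagonal. *)
Fixpoint uncpair (n : nat) : nat * nat :=
  if n is n'.+1 then
    let: (a, b) := uncpair n' in if a is a'.+1 then (a', b.+1) else (b.+1, 0)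
  else (0, 0).

Lemma uncpairK (n : nat) : cpair (uncpair n).1 (uncpair n).2 = n.
Proof.
elim: n => //= n; case: (uncpair n) => [[|a] b] /= <-.
  by rewrite /cpair !addn0 !add0n half_mulnSr; lia.
by rewrite /cpair addnS addSn; lia.
Qed.

Lemma cpairK (a b : nat) : uncpair (cpair a b) = (a, b).
Proof.
have /cpair_inj := uncpairK (cpair a b).
by case: (uncpair _) => x y /= [-> ->].
Qed.

(** An inversion principle in which indices such as [cpair a n] become equations, to which
    [cpair_inj] applies. *)
Lemma evalE (c : pcode) (x z : nat) : eval c x z ->
  match c with
  | CZero => z = 0
  | CSucc => z = x.+1
  | CFst => exists b, x = cpair z b
  | CSnd => exists a, x = cpair a z
  | CPair f g => exists a b, [/\ eval f x a, eval g x b & z = cpair a b]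
  | CComp f g => exists2 y, eval g x y & eval f y z
  | CPrec f g => exists a n, x = cpair a n /\
      if n is n'.+1 then
        exists2 y, eval (CPrec f g) (cpair a n') y & eval g (cpair a (cpair n' y)) z
      else eval f a z
  | CMu f => eval f (cpair x z) 0 /\
      forall m, m < z -> exists k, eval f (cpair x m) k.+1
  end.
Proof.
case=> //.
- by move=> a b; exists b.
- by move=> a b; exists a.
- by move=> f g {}x a b ? ?; exists a, b.
- by move=> f g {}x y {}z ? ?; exists y.
- by move=> f g {}x y ?; exists x, 0.
- by move=> f g {}x n y {}z ? ?; exists x, n.+1; split=> //; exists y.
Qed.

Lemma eval_det (c : pcode) (x z z' : nat) : eval c x z -> eval c x z' -> z = z'.
Proof.
elim: c x z z' => [||||f IHf g IHg|f IHf g IHg|f IHf g IHg|f IHf] x z z'.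
- by move=> /evalE-> /evalE->.
- by move=> /evalE-> /evalE->.
- by move=> /evalE[b ->] /evalE[b' /cpair_inj[]].
- by move=> /evalE[b ->] /evalE[b' /cpair_inj[]].
- move=> /evalE[a [b [fa gb ->]]] /evalE[a' [b' [fa' gb' ->]]].
  by rewrite (IHf _ _ _ fa fa') (IHg _ _ _ gb gb').
- move=> /evalE[y gy fz] /evalE[y' gy' fz'].
  by rewrite -(IHg _ _ _ gy gy') in fz'; apply: IHf fz fz'.
- move=> /evalE[a [n [-> H]]] /evalE[a' [n' [/cpair_inj[<- <-] H']]].
  (* The structural hypotheses only cover [f] and [g]; the recursion counter needs its own
     induction. *)
  elim: n z z' H H' => [|n IHn] z z'; first exact: IHf.
  move=> [y Hy gz] [y' Hy' gz'].
  have E : y = y'.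
    move: Hy Hy' => /evalE[? [? [/cpair_inj[<- <-] H]]].
    by move=> /evalE[? [? [/cpair_inj[<- <-] H']]]; apply: IHn H H'.
  by rewrite -E in gz'; apply: IHg gz gz'.
- move=> /evalE[f0 fS] /evalE[f0' fS'].
  case: (ltngtP z z') => // [/fS'[k Hk]|/fS[k Hk]].
    by have := IHf _ _ _ f0 Hk.
  by have := IHf _ _ _ f0' Hk.
Qed.

(** * Closure properties of total computable functions *)

Definition computable (F : nat -> nat) : Prop := exists c, forall x, eval c x (F x).

Definition computable2 (F : nat -> nat -> nat) : Prop :=
  exists c, forall x y, eval c (cpair x y) (F x y).

Lemma computable_fst : computable (fun x => (uncpair x).1).
Proof. by exists CFst => x; rewrite -{1}(uncpairK x); constructor. Qed.

Lemma computable_snd : computable (fun x => (uncpair x).2).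
Proof. by exists CSnd => x; rewrite -{1}(uncpairK x); constructor. Qed.

Lemma computable_comp (F G : nat -> nat) :
  computable F -> computable G -> computable (fun x => F (G x)).
Proof. by move=> [c cF] [d dG]; exists (CComp c d) => x; apply: ev_comp (dG x) (cF _). Qed.

Lemma computable_succ (F : nat -> nat) :
  computable F -> computable (fun x => (F x).+1).
Proof.
by case=> c cF; exists (CComp CSucc c) => x; apply: ev_comp (cF x) _; constructor.
Qed.

Lemma computable_const (k : nat) : computable (fun=> k).
Proof.
elim: k => [|k IH]; last exact: computable_succ.
by exists CZero => x; constructor.
Qed.

Lemma computable_id : computable id.
Proof.
have [[c cF] [d dF]] := (computable_fst, computable_snd).
by exists (CPair c d) => x; rewrite -{2}(uncpairK x); constructor.
Qed.

Lemma computable_comp2 (op : nat -> nat -> nat) (F G : nat -> nat) :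
  computable2 op -> computable F -> computable G -> computable (fun x => op (F x) (G x)).
Proof.
move=> [c cop] [d dF] [e eG]; exists (CComp c (CPair d e)) => x.
by apply: ev_comp (cop _ _); constructor.
Qed.

Lemma computable_rec (F : nat -> nat) (G : nat -> nat) (op : nat -> nat -> nat) :
  computable F -> computable G ->
  (forall a, op a 0 = F a) ->
  (forall a n, op a n.+1 = G (cpair a (cpair n (op a n)))) ->
  computable2 op.
Proof.
move=> [c cF] [d dG] op0 opS; exists (CPrec c d) => a; elim=> [|n IH].
  by rewrite op0; constructor.
by rewrite opS; apply: ev_precS IH _.
Qed.

(** [CPrec] passes [cpair a (cpair n y)] to its step function; this projection extracts the
    accumulated value [y]. *)
Lemma computable_acc : computable (fun x => (uncpair (uncpair x).2).2).
Proof. exact: computable_comp computable_snd computable_snd. Qed.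

Lemma computable_addn : computable2 addn.
Proof.
apply: (computable_rec _ _ _ computable_id (computable_succ _ computable_acc)).
  by move=> a; rewrite addn0.
by move=> a n; rewrite !cpairK addnS.
Qed.

Lemma computable_muln : computable2 muln.
Proof.
apply: (computable_rec _ _ _ (computable_const 0)
  (computable_comp2 _ _ _ computable_addn computable_fst computable_acc)).
  by move=> a; rewrite muln0.
by move=> a n; rewrite !cpairK mulnS.
Qed.

Lemma computable_expn : computable2 expn.
Proof.
apply: (computable_rec _ _ _ (computable_const 1)
  (computable_comp2 _ _ _ computable_muln computable_fst computable_acc)) => //.
by move=> a n; rewrite !cpairK expnS.
Qed.

Lemma computable_subn : computable2 subn.
Proof.
(* The predecessor is a primitive recursion whose step returns the counter; the first argument is a
   dummy because [computable_rec] yields binary functions. *)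
have Cpred : computable predn.
  apply: (computable_comp2 (fun _ n => n.-1) _ _ _ computable_id computable_id).
  apply: (computable_rec _ _ _ (computable_const 0)
    (computable_comp _ _ computable_fst computable_snd)) => // a n.
  by rewrite !cpairK.
apply: (computable_rec _ (fun x => (uncpair (uncpair x).2).2.-1) _ computable_id).
- exact: computable_comp Cpred computable_acc.
- by move=> a; rewrite subn0.
- by move=> a n; rewrite !cpairK subnS.
Qed.

(** Unbounded search for a zero of [T p], followed by [out]. If the zero is unique, all smaller
    arguments give successors, as [ev_mu] demands. *)
Lemma computable_search (T : nat -> nat -> nat) (out : nat -> nat) :
  computable2 T -> computable out ->
  exists M, (forall p z, eval M p z -> exists w, T p w = 0) /\
    forall p w, T p w = 0 -> (forall w', T p w' = 0 -> w' = w) -> eval M p (out w).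
Proof.
move=> [c cT] [d dout]; exists (CComp d (CMu c)); split=> [p z|p w Tw uniqw].
  by move=> /evalE[w /evalE[c0 _] _]; exists w; apply: eval_det (cT _ _) c0.
apply: ev_comp (dout w); apply: ev_mu => [|m mw]; first by rewrite -Tw.
have := cT p m; case E : (T p m) => [|k]; last by exists k.
by move: mw; rewrite (uniqw _ E) ltnn.
Qed.

(** * Arithmetic of string codes and the zero-padding machine *)

Lemma enc_inj : injective enc.
Proof.
elim=> [|b s IH] [|b' s'] //= E; try lia.
have -> : b = b' by case: b b' E => -[] /=; lia.
by congr cons; apply: IH; lia.
Qed.

Lemma enc_surj (n : nat) : exists s, enc s = n.
Proof.
have [m] := ubnP n; elim: m n => // m IH [_|n nm]; first by exists [::].
have [|s Es] := IH n./2; first lia.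
by exists (odd n :: s); rewrite /= Es; lia.
Qed.

(** In binary, least significant digit first, [(enc s).+1] is [s] followed by a 1. *)
Lemma enc_size (s : seq bool) : 2 ^ size s <= (enc s).+1 < 2 ^ (size s).+1.
Proof. by elim: s => //= b s; rewrite !expnS; case: b => /=; lia. Qed.

Lemma enc_cat (s t : seq bool) : enc (s ++ t) = enc s + 2 ^ size s * enc t.
Proof. by elim: s => [|b s IH]; rewrite /= ?mul1n // IH expnS; lia. Qed.

Lemma enc_nseq_false (m : nat) : enc (nseq m false) = 2 ^ m - 1.
Proof.
by elim: m => //= m ->; rewrite expnS; have := expn_gt0 2 m; lia.
Qed.

(** Prepending [true] to [t] doubles [enc t + 2]. *)
Lemma enc_unary (a : nat) (s : seq bool) :
  enc (nseq a true ++ false :: s) + 2 = 2 ^ a * ((enc s).*2 + 3).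
Proof. by elim: a => [|a IH] /=; rewrite ?expnS; lia. Qed.

Lemma prefix_unary (a a' : nat) (s s' : seq bool) :
  prefix (nseq a true ++ false :: s) (nseq a' true ++ false :: s') ->
  a = a' /\ prefix s s'.
Proof.
by elim: a a' => [|a IH] [|a'] //= /IH[-> ?].
Qed.

(* Self-delimiting once [rho] is required to have length [a^2]; the intended
   output is [rho] padded with zeros to length [b^2]. *)
Definition zero_pad_prog (a b : nat) (rho : seq bool) : seq bool :=
  nseq a true ++ false :: nseq b true ++ false :: rho.

Lemma prefix_zero_pad_prog (a b a' b' : nat) (rho rho' : seq bool) :
  prefix (zero_pad_prog a b rho) (zero_pad_prog a' b' rho') ->
  [/\ a = a', b = b' & prefix rho rho'].
Proof. by move=> /prefix_unary[-> /prefix_unary[-> ?]]. Qed.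

Lemma enc_zero_pad_prog (a b : nat) (rho : seq bool) :
  enc (zero_pad_prog a b rho) + 2 + 2 ^ a =
  2 ^ (a + b).+1 * ((enc rho).*2 + 3).
Proof.
have E := enc_unary b rho.
rewrite enc_unary; have := expn_gt0 2 b; rewrite expnS expnD; nia.
Qed.

Lemma prefix_size_eq (s t : seq bool) : size s = size t -> prefix s t -> s = t.
Proof. by rewrite prefixE => -> /eqP <-; rewrite take_size. Qed.

(** The machine searches for the triple [(a, b, rho)] that its input describes. Writing only the
    square roots of the two lengths in unary keeps the overhead [a + b] negligible against the
    output length [b ^ 2]. *)
Lemma zero_pad_machine : exists M, prefix_free_machine M /\
  forall a b rho, size rho = a ^ 2 -> a <= b ->
    runs M (zero_pad_prog a b rho) (rho ++ nseq (b ^ 2 - a ^ 2) false).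
Proof.
pose qa w := (uncpair w).1; pose qb w := (uncpair (uncpair w).2).1.
pose qr w := (uncpair (uncpair w).2).2.
pose lhs p w := p + 2 + 2 ^ qa w.
pose rhs w := 2 ^ (qa w + qb w + 1) * (qr w + qr w + 3).
(* Truncated differences as tests: the first two vanish when [p] codes the program of the triple
   [w], the last two when [size rho = a ^ 2], by [enc_size]. *)
pose T p w := lhs p w - rhs w + (rhs w - lhs p w) +
  (2 ^ (qa w ^ 2) - (qr w + 1) + (qr w + 2 - 2 ^ (qa w ^ 2 + 1))).
(* Appending [m] zeros to [rho] adds [2 ^ size rho * (2 ^ m - 1)] to its code; here
   [size rho = a ^ 2] and [m = b ^ 2 - a ^ 2]. *)
pose out w := qr w + (2 ^ (qb w ^ 2) - 2 ^ (qa w ^ 2)).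
have Cc := computable_const.
have CA F G (CF : computable F) (CG : computable G) :=
  computable_comp2 _ F G computable_addn CF CG.
have CB F G (CF : computable F) (CG : computable G) :=
  computable_comp2 _ F G computable_subn CF CG.
have CM F G (CF : computable F) (CG : computable G) :=
  computable_comp2 _ F G computable_muln CF CG.
have CE F G (CF : computable F) (CG : computable G) :=
  computable_comp2 _ F G computable_expn CF CG.
have C1 := computable_fst; have C2 := computable_snd.
have Ca : computable qa := C1.
have Cb : computable qb := computable_comp _ _ C1 C2.
have Cr : computable qr := computable_comp _ _ C2 C2.
have Cs F : computable F -> computable (fun x => F (uncpair x).2).
  by move=> CF; apply: computable_comp CF C2.
have Cout : computable out.
  by apply: (CA) => //; apply: (CB); apply: (CE (fun=> 2)) => //; apply: (CE _ (fun=> 2)).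
have Crhs : computable rhs.
  apply: (CM); last by apply: (CA) => //; apply: (CA).
  by apply: (CE (fun=> 2)) => //; apply: (CA) => //; apply: (CA) => //; apply: (CA).
have Clhs : computable (fun x => lhs (uncpair x).1 (uncpair x).2).
  apply: (CA); first exact: (CA _ (fun=> 2)).
  by apply: (CE (fun=> 2)) => //; apply: Cs.
have Csq : computable (fun w => qa w ^ 2) by apply: (CE _ (fun=> 2)).
have Cle : computable (fun w => 2 ^ (qa w ^ 2) - (qr w + 1)).
  by apply: (CB); [exact: (CE (fun=> 2)) | exact: (CA _ (fun=> 1))].
have Clt : computable (fun w => qr w + 2 - 2 ^ (qa w ^ 2 + 1)).
  apply: (CB); first exact: (CA _ (fun=> 2)).
  by apply: (CE (fun=> 2)) => //; apply: (CA _ (fun=> 1)).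
have CT : computable2 T.
  have [c cT] : computable (fun x => T (uncpair x).1 (uncpair x).2).
    apply: (CA); apply: (CA).
    - exact: CB Clhs (Cs _ Crhs).
    - exact: CB (Cs _ Crhs) Clhs.
    - exact: Cs _ Cle.
    - exact: Cs _ Clt.
  by exists c => p w; have := cT (cpair p w); rewrite cpairK.
have [M [Mdom Mout]] := computable_search T out CT Cout.
have szE rho n : (size rho == n) = (2 ^ n <= (enc rho).+1 < 2 ^ n.+1).
  have /andP[E1 E2] := enc_size rho.
  apply/eqP/andP => [<-|[H1 H2]]; first by split.
  have := leq_ltn_trans E1 H2; have := leq_ltn_trans H1 E2.
  by rewrite !ltn_exp2l //; lia.
have TP p a b rho : T p (cpair a (cpair b (enc rho))) = 0 <->
    p = enc (zero_pad_prog a b rho) /\ size rho = a ^ 2.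
  have := szE rho (a ^ 2); have := enc_zero_pad_prog a b rho.
  rewrite /T /lhs /rhs /qa /qb /qr !cpairK /= !addn1 -addnn => E S; split.
    by move=> H; split; [lia | apply/eqP; rewrite S; lia].
  by move=> [-> /eqP]; rewrite S => H; lia.
have wE w : exists a b rho, w = cpair a (cpair b (enc rho)).
  have [rho Er] := enc_surj (qr w); exists (qa w), (qb w), rho.
  by rewrite Er !uncpairK.
exists M; split=> [tau tau'|a b rho szr ab].
  move=> [z /Mdom[w]] + [z' /Mdom[w']].
  have [[a [b [rho ->]]] [a' [b' [rho' ->]]]] := (wE w, wE w').
  move=> /TP[/enc_inj -> sz] /TP[/enc_inj -> sz'].
  move=> /prefix_zero_pad_prog[Ea -> /prefix_size_eq ->]; first by rewrite Ea.
  by rewrite sz sz' Ea.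
have outE : out (cpair a (cpair b (enc rho))) = enc (rho ++ nseq (b ^ 2 - a ^ 2) false).
  rewrite /out /qa /qb /qr !cpairK /= enc_cat enc_nseq_false szr mulnBr muln1 -expnD.
  by rewrite subnKC // leq_exp2r.
rewrite /runs -outE; apply: Mout; first exact/TP.
move=> w'; have [a' [b' [rho' ->]]] := wE w'.
move=> /TP[/enc_inj E sz'].
have /prefix_zero_pad_prog[Ea Eb] : prefix (zero_pad_prog a b rho) (zero_pad_prog a' b' rho').
  by rewrite E prefix_refl.
by move=> /prefix_size_eq ->; rewrite ?Ea ?Eb // szr sz' Ea.
Qed.

Lemma optimal_zero_pad (U : pcode) : optimal_pf_machine U -> exists c, forall a b rho,
  size rho = a ^ 2 -> a <= b -> exists2 p, runs U p (rho ++ nseq (b ^ 2 - a ^ 2) false) &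
    size p <= a ^ 2 + a + b + c.
Proof.
have [M [Mpf runM]] := zero_pad_machine.
(* The two extra units pay for the [false] terminators of the unary blocks. *)
move=> [_ /(_ M Mpf)[c Uc]]; exists c.+2 => a b rho szr ab.
have [p [Up szp]] := Uc _ _ (runM a b rho szr ab).
exists p => //; move: szp.
by rewrite /zero_pad_prog size_cat /= size_cat /= !size_nseq szr; lia.
Qed.

Lemma runs_det (U : pcode) (p sigma sigma' : seq bool) :
  runs U p sigma -> runs U p sigma' -> sigma = sigma'.
Proof. by move=> H H'; apply: enc_inj; apply: eval_det H H'. Qed.

Local Open Scope classical_set_scope.
Local Open Scope ring_scope.

(** * Kraft's inequality and mass distributions *)

Lemma prefix_rconsl (b : bool) (tau t : seq bool) :
  prefix (rcons tau b) t = [&& prefix tau t, (size tau < size t)%N & nth false t (size tau) == b].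
Proof.
elim: tau t => [|a tau IH] [|c t] //=; first by rewrite prefix0s andbT eq_sym.
by rewrite IH -andbA.
Qed.

Lemma prefix_rconsr (b : bool) (tau t : seq bool) :
  prefix t (rcons tau b) = prefix t tau || (t == rcons tau b).
Proof.
elim: tau t => [|a tau IH] [|c t] //=.
by rewrite IH eqseq_cons; case: (c == a).
Qed.

(** Kraft's inequality is localised at [tau] so that induction can pass to the two one-bit
    extensions of [tau]. If [tau] is in [P], prefix-freeness leaves it as the only summand. *)
Lemma kraft_extensions (R : realType) (P : seq (seq bool)) : uniq P ->
  (forall p q, p \in P -> q \in P -> prefix p q -> p = q) ->
  forall tau, \sum_(p <- P | prefix tau p) (2%:R : R) ^- size p <= 2%:R ^- size tau.
Proof.
(* The induction is on [d], which bounds how much longer than [tau] the members of [P] are. *)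
move=> uP pfP; suff H d tau : (forall p, p \in P -> (size p <= size tau + d)%N) ->
    \sum_(p <- P | prefix tau p) (2%:R : R) ^- size p <= 2%:R ^- size tau.
  move=> tau; apply: (H (\max_(p <- P) size p)%N) => p pP.
  by apply: leq_trans (leq_addl _ _); rewrite (big_rem p) //= leq_maxl.
elim: d tau => [|d IH] tau szP; case: (boolP (tau \in P)) => [tP|tnP].
1,3: rewrite -big_filter (bigD1_seq tau) ?filter_uniq ?mem_filter ?prefix_refl //=;
  rewrite big_seq_cond big1 ?addr0 // => p; rewrite mem_filter => /andP[/andP[tp pP]];
  by rewrite (pfP _ _ tP pP tp) eqxx.
- rewrite big_seq_cond big1 ?invr_ge0 ?exprn_ge0 // => p /andP[pP tp].
  case/negP: tnP; suff -> : tau = p by [].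
  apply: prefix_size_eq => //; apply/eqP; rewrite eqn_leq size_prefix //=.
  by have := szP p pP; rewrite addn0.
- have szPr b p : p \in P -> (size p <= size (rcons tau b) + d)%N.
    by move=> /szP; rewrite size_rcons addSnnS.
  have := lerD (IH _ (szPr false)) (IH _ (szPr true)).
  rewrite !size_rcons.
  have -> : (2%:R : R) ^- (size tau).+1 + 2%:R ^- (size tau).+1 = 2%:R ^- size tau.
    by rewrite exprS invfM; lra.
  apply: le_trans.
  rewrite [leLHS]big_mkcond [X in _ <= X + _]big_mkcond [X in _ <= _ + X]big_mkcond.
  rewrite -big_split /= big_seq [leRHS]big_seq; apply: ler_sum => p pP.
  rewrite !prefix_rconsl; case tp : (prefix tau p) => /=; last by rewrite addr0.
  have -> : (size tau < size p)%N.
    rewrite ltnNge; apply: contra tnP => le; rewrite (prefix_size_eq tau p) //.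
    by apply/eqP; rewrite eqn_leq le size_prefix.
  by case: (nth _ _ _) => /=; rewrite ?addr0 ?add0r.
Qed.

Lemma kraft (R : realType) (P : seq (seq bool)) : uniq P ->
  (forall p q, p \in P -> q \in P -> prefix p q -> p = q) ->
  \sum_(p <- P) (2%:R : R) ^- size p <= 1.
Proof.
move=> uP pfP; have := kraft_extensions R P uP pfP [::].
by rewrite expr0 invr1; under eq_bigl do rewrite prefix0s.
Qed.

(** [cover_cost f] is the instance [phi t := f (2%:R ^- size t)]. *)
Definition family_mass (R : realType) (phi : seq bool -> R)
    (T : nat -> option (seq bool)) : \bar R :=
  (\sum_(i <oo) match T i with Some t => (phi t)%:E | None => 0 end)%E.

Lemma family_mass_term_ge0 (R : realType) (phi : seq bool -> R) (o : option (seq bool)) :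
  (forall t, 0 <= phi t) -> (0 <= match o with Some t => (phi t)%:E | None => 0 end)%E.
Proof. by move=> phi0; case: o => // t; rewrite lee_fin. Qed.

Lemma family_mass_ge0 (R : realType) (phi : seq bool -> R) (T : nat -> option (seq bool)) :
  (forall t, 0 <= phi t) -> (0 <= family_mass R phi T)%E.
Proof. by move=> phi0; apply: nneseries_ge0 => i _ _; exact: family_mass_term_ge0. Qed.

Lemma family_massD (R : realType) (phi psi : seq bool -> R) (T : nat -> option (seq bool)) :
  (forall t, 0 <= phi t) -> (forall t, 0 <= psi t) ->
  (family_mass R (fun t => phi t + psi t)%R T = family_mass R phi T + family_mass R psi T)%E.
Proof.
move=> phi0 psi0; rewrite /family_mass -nneseriesD; last 2 first.
- by move=> i _ _; exact: family_mass_term_ge0.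
- by move=> i _ _; exact: family_mass_term_ge0.
by apply: eq_eseriesr => i _; case: (T i) => [t|]; rewrite ?adde0.
Qed.

Lemma le_family_mass (R : realType) (phi psi : seq bool -> R) (T : nat -> option (seq bool)) :
  (forall t, 0 <= phi t) -> (forall t, phi t <= psi t) ->
  (family_mass R phi T <= family_mass R psi T)%E.
Proof.
move=> phi0 le; apply: lee_nneseries => i _; first by move=> _; exact: family_mass_term_ge0.
by case: (T i) => [t|] //; rewrite lee_fin.
Qed.

Lemma family_mass_ge_term (R : realType) (phi : seq bool -> R)
    (T : nat -> option (seq bool)) (i : nat) (t : seq bool) :
  (forall t, 0 <= phi t) -> T i = Some t -> ((phi t)%:E <= family_mass R phi T)%E.
Proof.
move=> phi0 Ti.
apply: le_trans (nneseries_lim_ge i.+1 _); last by move=> j _ _; exact: family_mass_term_ge0.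
rewrite big_nat_recr //= Ti leeDr // sume_ge0 // => j _.
exact: family_mass_term_ge0.
Qed.

Lemma family_mass_le (R : realType) (phi : seq bool -> R)
    (T : nat -> option (seq bool)) (x : \bar R) :
  (forall t, 0 <= phi t) ->
  (forall n, \sum_(i < n) match T i with Some t => (phi t)%:E | None => 0 end <= x)%E ->
  (family_mass R phi T <= x)%E.
Proof.
move=> phi0 le; apply: lime_le.
  by apply: is_cvg_nneseries => i _ _; exact: family_mass_term_ge0.
by apply: nearW => n; rewrite big_mkord.
Qed.

(** The index [i] encodes a program and [T i] is its output, if it halts and satisfies [P]. Each
    weight is thus charged to the term of one program in Kraft's inequality. *)
Lemma halting_family (R : realType) (U : pcode) (P : seq bool -> seq bool -> Prop) :
  prefix_free_machine U -> exists T : nat -> option (seq bool),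
  [/\ forall p sigma, runs U p sigma -> P p sigma -> exists i, T i = Some sigma,
      forall i sigma, T i = Some sigma -> exists2 p, runs U p sigma & P p sigma &
      forall (phi : seq bool -> R) (e : R), (forall t, 0 <= phi t) -> 0 <= e ->
        (forall p sigma, runs U p sigma -> P p sigma -> phi sigma <= e * 2%:R ^- size p) ->
        (family_mass R phi T <= e%:E)%E].
Proof.
move=> pfU.
pose Q i o := forall sigma, o = Some sigma <->
  exists p, [/\ pickle_inv i = Some p, runs U p sigma & P p sigma].
have exQ i : exists o, Q i o.
  have [[sigma [p [Ep Up Pp]]]|none] :=
      pselect (exists sigma p, [/\ pickle_inv i = Some p, runs U p sigma & P p sigma]).
    exists (Some sigma) => sigma'; split=> [[<-]|]; first by exists p.
    by rewrite Ep => -[p' [[<-] Up' _]]; rewrite (runs_det _ _ _ _ Up Up').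
  by exists None => sigma; split=> // -[p H]; case: none; exists sigma, p.
have [T TQ] := choice exQ; exists T; split.
- by move=> p sigma Up Pp; exists (pickle p); apply/TQ; exists p; rewrite pickleK_inv.
- by move=> i sigma /TQ[p [_ Up Pp]]; exists p.
move=> phi e phi0 e0 le; apply: family_mass_le => // n.
pose D := [seq p <- pmap pickle_inv (iota 0 n) | `[< halts U p >]].
have uD : uniq D by rewrite filter_uniq // (pmap_uniq pickle_invK) // iota_uniq.
have := kraft R D uD; rewrite big_filter big_mkcond big_pmap => /(_ _)/wrap[|K].
  by move=> p q; rewrite !mem_filter => /andP[/asboolP Hp _] /andP[/asboolP Hq _]; apply: pfU.
apply: (@le_trans _ _ (e * \sum_(j <- iota 0 n)
    oapp (fun p => if `[< halts U p >] then 2%:R ^- size p else 0) 0 (pickle_inv j))%:E); last first.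
  by rewrite lee_fin -[leRHS]mulr1 ler_wpM2l.
rewrite -(big_mkord xpredT (fun i => match T i with Some t => (phi t)%:E | None => 0%E end)).
rewrite mulr_sumr -sumEFin /index_iota subn0; apply: lee_sum => i _.
case Ti : (T i) => [t|]; last first.
  by rewrite lee_fin mulr_ge0 //; case: (pickle_inv i) => //= p; case: ifP => // _; rewrite invr_ge0 exprn_ge0.
move: Ti => /TQ[p [-> Up Pp]] /=; rewrite lee_fin.
by rewrite (asboolT (ex_intro _ t Up)); apply: le.
Qed.

(** A finite Borel measure on Cantor space, given by its values on cylinders. *)
Definition is_mass (R : realType) (mu : seq bool -> R) : Prop :=
  (forall t, 0 <= mu t) /\ forall t, mu (rcons t false) + mu (rcons t true) = mu t.

(** The mass of the intersection of the cylinders of [tau] and [t], which are nested or disjoint. *)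
Definition meet_mass (R : realType) (mu : seq bool -> R) (tau t : seq bool) : R :=
  if prefix t tau then mu tau else if prefix tau t then mu t else 0.

Lemma meet_massD (R : realType) (mu : seq bool -> R) (tau t : seq bool) : is_mass R mu ->
  meet_mass R mu (rcons tau false) t + meet_mass R mu (rcons tau true) t = meet_mass R mu tau t.
Proof.
move=> [_ muD]; rewrite /meet_mass !prefix_rconsr !prefix_rconsl.
case: (boolP (prefix t tau)) => [|nttau]; first by rewrite /= muD.
case: (boolP (prefix tau t)) => [taut|ntaut] /=.
  have st : (size tau < size t)%N.
    rewrite ltnNge; apply: contra nttau => le.
    rewrite (_ : t = tau) ?prefix_refl //; apply/esym/prefix_size_eq => //.
    by apply/eqP; rewrite eqn_leq le size_prefix.
  rewrite st /=.
  have nbE b : (t == rcons tau b) -> nth false t (size tau) == b.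
    by move=> /eqP ->; rewrite nth_rcons ltnn eqxx.
  case: (boolP (t == rcons tau false)) => [/[dup] /nbE /eqP -> /eqP ->|_].
    by rewrite eqseq_rcons /= andbF addr0.
  case: (boolP (t == rcons tau true)) => [/[dup] /nbE /eqP -> /eqP ->|_]; first by rewrite add0r.
  by case: (nth _ _ _); rewrite ?addr0 ?add0r.
have nE b : (t == rcons tau b) = false.
  by apply: contraNF ntaut => /eqP ->; exact: prefix_rcons.
by rewrite !nE addr0.
Qed.

Lemma infinite_path (P : seq bool -> Prop) : P [::] ->
  (forall tau, P tau -> exists b, P (rcons tau b)) -> exists x : cantor, forall n, P (restr x n).
Proof.
move=> P0 PS.
have /choice[h hP] : forall tau, exists b, P tau -> P (rcons tau b).
  move=> tau; have [/PS[b Pb]|nP] := pselect (P tau); first by exists b.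
  by exists false => /nP.
pose t := fix t n := if n is n'.+1 then rcons (t n') (h (t n')) else [::].
exists (fun n => h (t n)) => n; suff -> : restr (fun n => h (t n)) n = t n.
  by elim: n => //= n /hP.
by elim: n => // n IH; rewrite /restr mkseqS -/(restr _ n) IH.
Qed.

Lemma cyl_restr (t : seq bool) (x : cantor) : cyl t x <-> restr x (size t) = t.
Proof.
split=> [tx|<- i]; last by rewrite size_mkseq => ?; rewrite nth_mkseq.
apply: (@eq_from_nth _ false); rewrite size_mkseq // => i it.
by rewrite nth_mkseq // tx.
Qed.

(* Measure-theoretic regularity is replaced by a greedy choice of bits: the
   mass removed from a cylinder by the two families stays below its own mass
   for at least one of its halves. *)
Lemma escape (R : realType) (mu : seq bool -> R) (T1 T2 : nat -> option (seq bool)) :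
  is_mass R mu -> (family_mass R mu T1 + family_mass R mu T2 < (mu [::])%:E)%E ->
  exists x : cantor, [/\ forall n, 0 < mu (restr x n),
    forall i t, T1 i = Some t -> ~ cyl t x & forall i t, T2 i = Some t -> ~ cyl t x].
Proof.
move=> mass; have [mu0 muD] := mass.
have m0 tau t : 0 <= meet_mass R mu tau t by rewrite /meet_mass; case: ifP => // _; case: ifP.
(* The mass, counted with multiplicity, that the family [T] covers inside the cylinder of [tau]. *)
pose w T tau := family_mass R (meet_mass R mu tau) T.
have w0 T tau : (0 <= w T tau)%E by exact: family_mass_ge0.
have wD T tau : (w T (rcons tau false) + w T (rcons tau true) = w T tau)%E.
  by rewrite /w -family_massD //; congr (family_mass R _ T); apply/funext => t; exact: meet_massD.
have wnil T : w T [::] = family_mass R mu T.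
  by congr (family_mass R _ T); apply/funext => t; rewrite /meet_mass; case: t.
(* A cylinder inside a member of [T] is fully covered, so the strict inequality kept along the path
   excludes every member. *)
have wge T i t tau : T i = Some t -> prefix t tau -> ((mu tau)%:E <= w T tau)%E.
  move=> Ti ttau; apply: le_trans (family_mass_ge_term _ _ _ _ _ (m0 tau) Ti).
  by rewrite /meet_mass ttau.
move=> lt; have [||x xP] := infinite_path (fun tau => (w T1 tau + w T2 tau < (mu tau)%:E)%E).
- by rewrite !wnil.
- move=> tau lttau; apply: contrapT => /forallNP no.
  move: lttau; apply/negP; rewrite -leNgt -muD EFinD.
  rewrite -(wD T1) -(wD T2) addeACA.
  by apply: leeD; rewrite leNgt; apply/negP; exact: no.
exists x; split=> [n|i t Ti /cyl_restr tx|i t Ti /cyl_restr tx].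
- by rewrite -lte_fin; apply: le_lt_trans (xP n); apply: adde_ge0.
- have := xP (size t); rewrite tx ltNge => /negP; apply.
  by apply: le_trans (wge _ _ _ t Ti (prefix_refl _)) (leeDl _ _).
- have := xP (size t); rewrite tx ltNge => /negP; apply.
  by apply: le_trans (wge _ _ _ t Ti (prefix_refl _)) (leeDr _ _).
Qed.

(** * Effective dimension and gauge functions *)

Lemma limn_einf_sup_einfs (R : realType) (u : nat -> \bar R) :
  limn_einf u = ereal_sup (range (einfs u)).
Proof. by rewrite limn_einf_lim; apply/cvg_lim => //; exact: cvg_einfs_sup. Qed.

Lemma eff_dim_ge (R : realType) (U : pcode) (x : cantor) (s : R) (c : nat) :
  (forall n p, runs U p (restr x n) -> s * n%:R <= (size p + c)%:R) ->
  (s%:E <= eff_dim U x)%E.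
Proof.
move=> H; rewrite /eff_dim limn_einf_sup_einfs; apply/lee_subgt0Pr => e e0.
have [N cN] : exists N : nat, c%:R < e * N.+1%:R.
  exists (Num.bound (c%:R / e)); rewrite -ltr_pdivrMl // mulrC.
  apply: lt_trans (unstable.ltr_bound _) _; by rewrite ltr_nat.
apply: le_ereal_sup_tmp; exists (einfs (fun n => (@KC R U (restr x n) * (n%:R^-1)%:E)%E) N.+1).
  by exists N.+1.
apply: le_ereal_inf_tmp => _ [k /= Nk <-].
have k0 : (0 < k%:R :> R) by rewrite ltr0n; lia.
rewrite lee_pdivlMr //; apply: le_ereal_inf_tmp => _ [p /= Hp <-].
rewrite -EFinB -EFinM lee_fin.
have := H k p Hp; have : N.+1%:R <= (k%:R : R) by rewrite ler_nat.
rewrite natrD => ? ?; nra.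
Qed.

Lemma eff_dim_le (R : realType) (U : pcode) (x : cantor) (s : R) :
  (forall r, s < r -> forall N, exists n p, [/\ (N <= n)%N, (0 < n)%N,
     runs U p (restr x n) & (size p)%:R <= r * n%:R]) ->
  (eff_dim U x <= s%:E)%E.
Proof.
move=> H; rewrite /eff_dim limn_einf_sup_einfs; apply: ge_ereal_sup => _ [N _ <-].
apply/lee_addgt0Pr => e e0.
have [|n [p [Nn n0 Up szp]]] := H (s + e) _ N; first by rewrite ltrDl.
apply: (@le_trans _ _ (@KC R U (restr x n) * (n%:R^-1)%:E)%E).
  by apply: ereal_inf_lbound; exists n.
have n0R : (0 < n%:R :> R) by rewrite ltr0n.
rewrite lee_pdivrMr //; apply: (@le_trans _ _ (size p)%:R%:E); last by rewrite -EFinD -EFinM lee_fin.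
by apply: ereal_inf_lbound; exists p.
Qed.

Lemma eff_dim_lt (R : realType) (U : pcode) (x : cantor) (q : R) : (eff_dim U x < q%:E)%E ->
  forall N, exists n p, [/\ (N <= n)%N, runs U p (restr x n) & (size p)%:R <= q * n%:R].
Proof.
rewrite /eff_dim limn_einf_sup_einfs => lt N.
(* Starting at [N.+1] excludes [n = 0], where the inverse is 0 by convention. *)
have : (einfs (fun n => (@KC R U (restr x n) * (n%:R^-1)%:E)%E) N.+1 < q%:E)%E.
  by apply: le_lt_trans lt; apply: ereal_sup_ubound; exists N.+1.
move=> /ereal_inf_lt[_ [n /= Nn <-]].
rewrite lte_pdivrMr ?ltr0n; last by lia.
move=> /ereal_inf_lt[_ [p /= Up <-]]; rewrite -EFinM lte_fin => /ltW szp.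
by exists n, p; split => //; lia.
Qed.

Lemma exists_expV2_lt (R : realType) (y : R) : 0 < y -> exists n, 2%:R ^- n < y.
Proof.
move=> y0; exists (Num.bound y^-1); rewrite invf_plt ?posrE ?exprn_gt0 //.
by apply: lt_trans (unstable.ltr_bound _) _; rewrite -natrX ltr_nat ltn_expl.
Qed.

(** For the least [b], either [b = 0] or [(b - 1) ^ 2 < n], so rounding up to a square costs at most
    [2 * b], negligible against [b ^ 2]. *)
Lemma square_ceil (n : nat) : exists b,
  [/\ (n <= b ^ 2)%N, (b ^ 2 <= n + 2 * b)%N & forall c, (n <= c ^ 2)%N -> (b <= c)%N].
Proof.
have exb : exists b, (n <= b ^ 2)%N by exists n; case: n => // n; rewrite -mulnn leq_pmulr.
case: (ex_minnP exb) => -[|b] nb minb; first by exists 0%N.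
exists b.+1; split => //.
have : ~~ (n <= b ^ 2)%N by apply/negP => /minb; rewrite ltnn.
by rewrite -!mulnn -ltnNge mulnS !mulSn; move: (b * b)%N => c; lia.
Qed.

Lemma gauge_exponent (R : realType) (f : R -> R) (s : R) : gauge f ->
  {in `]0, +oo[ &, forall x y, x <= y -> y^-1 * f y <= x^-1 * f x} ->
  0 <= s -> s < 1 -> (forall r : R, s < r <= 1 -> ~ ev_le f (fun x => x `^ r)) ->
  exists G : nat -> nat, [/\ forall n, (G n <= G n.+1 <= (G n).+1)%N,
    forall n, 2%:R ^- G n <= f (2%:R ^- n), forall n, s * n%:R <= (G n)%:R &
    forall r, s < r -> forall N, exists2 b, (N <= b)%N & (G (b ^ 2)%N)%:R <= r * (b ^ 2)%:R].
Proof.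
move=> [_ [fmono [fpos _]]] fdec s0 s1 nle.
have p2 n : 0 < (2%:R : R) ^- n by rewrite invr_gt0 exprn_gt0.
have i2 n : (2%:R : R) ^- n \in `]0, +oo[ by rewrite in_itv /= p2.
have half n : (2%:R : R) ^- n.+1 = 2%:R ^- n / 2%:R by rewrite exprS invfM mulrC.
pose Q n k := (2%:R ^- k <= f (2%:R ^- n)) && (s * n%:R <= k%:R).
have exQ n : exists k, Q n k.
  have [k kf] := exists_expV2_lt R _ (fpos _ (p2 n)); exists (k + n)%N; apply/andP; split.
    apply: le_trans (ltW kf); rewrite lef_pV2 ?posrE ?exprn_gt0 //.
    by apply: ler_weXn2l; rewrite ?ler1n // leq_addr.
  by rewrite natrD; have := ler0n R n; have := ler0n R k; nra.
pose G n := ex_minn (exQ n).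
have GQ n : Q n (G n) by rewrite /G; case: ex_minnP.
have Gle n k : Q n k -> (G n <= k)%N by rewrite /G; case: ex_minnP => m _ H /H.
have GS n : (G n <= G n.+1 <= (G n).+1)%N.
  apply/andP; split; apply: Gle; apply/andP; split.
  - have /andP[/le_trans + _] := GQ n.+1; apply; apply: fmono => //.
    by rewrite half; have := p2 n; lra.
  - have /andP[_] := GQ n.+1; apply: le_trans.
    by rewrite ler_wpM2l // ler_nat.
  - have /andP[H _] := GQ n.
    have := fdec _ _ (i2 n.+1) (i2 n); rewrite !half => /(_ _)/wrap[|].
      by have := p2 n; lra.
    move: H (p2 n); move: (2%:R ^- n) (2%:R ^- G n) => a g ga a0 D.
    have a20 : 0 < a / 2%:R by lra.
    move: D; rewrite -(ler_pM2l a20) mulVKf ?lt0r_neq0 //.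
    have -> : a / 2%:R * (a^-1 * f a) = f a / 2%:R by field; rewrite lt0r_neq0.
    lra.
  - have /andP[_ H] := GQ n.
    by rewrite -!natr1 mulrDr mulr1 lerD // ltW.
have Glip n m : (G (n + m) <= G n + m)%N.
  by elim: m => [|m IH]; rewrite ?addn0 // !addnS; have /andP[_] := GS (n + m)%N; lia.
exists G; split => [//|n|n|r sr N]; [by have /andP[] := GQ n | by have /andP[] := GQ n |].
(* Staying below [r] leaves slack for the rounding errors; the cap at 1 puts [r'] in the range of
   the hypothesis. *)
pose r' : R := Num.min ((s + r) / 2) 1.
have [sr' r'1] : s < r' /\ r' <= 1 by split; rewrite /r'; case: (ltP ((s + r) / 2) 1) => ?; lra.
have r'r : r' < r by rewrite /r'; case: (ltP ((s + r) / 2) 1) => ?; lra.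
pose M := maxn N (Num.bound (4%:R / (r - r'))).+1.
have [x [x0 xM fx]] : exists x : R, [/\ 0 < x, x < 2%:R ^- (M ^ 2)%N & x `^ r' < f x].
  apply: contrapT => no; apply: (nle r'); first by rewrite sr'.
  exists (2%:R ^- (M ^ 2)%N) => // x /andP[x0 xM]; rewrite leNgt; apply/negP => fx.
  by apply: no; exists x.
(* The least such [n] gives [2^-(n+1) < x <= 2^-n]. *)
have exn : exists n, (2%:R : R) ^- n.+1 < x.
  have [n xn] := exists_expV2_lt R _ x0; exists n; apply: le_lt_trans xn.
  by rewrite half; have := p2 n; lra.
case: (ex_minnP exn) => n nx minn.
have Mn : (M ^ 2 <= n)%N.
  have := lt_trans nx xM; rewrite ltf_pV2 ?posrE ?exprn_gt0 // ltr_eXn2l ?ltr1n //.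
have M0 : (0 < M)%N by rewrite /M; lia.
have xn : x <= 2%:R ^- n.
  case: n nx minn Mn => [|n] nx minn Mn; first by lia.
  by rewrite leNgt; apply/negP => /minn; rewrite ltnn.
pose k := (Num.truncn (n.+1%:R * r')).+1.
have nr0 : 0 <= n.+1%:R * r' by rewrite mulr_ge0 ?ler0n //; lra.
have /andP[kle kgt] := truncn_itv nr0.
have Qk : Q n k.
  apply/andP; split; last first.
    apply: le_trans (ltW kgt); rewrite -natr1; have := ler0n R n; nra.
  apply: le_trans (fmono _ _ _ (i2 n) xn); last by rewrite in_itv /= x0.
  apply: le_trans (ltW fx).
  apply: le_trans (_ : _ <= (2%:R ^- n.+1) `^ r') _; last first.
    by apply: ge0_ler_powR; rewrite ?nnegrE ?ltW //; lra.
  rewrite -!powR_invn // -powRrM ler_powR ?ler1n // mulNr lerN2.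
  exact: ltW.
have [b [bn nb _]] := square_ceil n.
have Mb : (M <= b)%N by rewrite -(leq_exp2r _ _ (isT : 0 < 2)%N) (leq_trans Mn).
exists b; first by apply: leq_trans Mb; rewrite leq_maxl.
have bR : 4%:R < (r - r') * b%:R.
  rewrite -ltr_pdivrMl ?subr_gt0 // mulrC; apply: lt_le_trans (unstable.ltr_bound _) _.
  by rewrite ler_nat; apply: leq_trans Mb; apply: leq_trans (leqnSn _) (leq_maxr _ _).
have : (G (b ^ 2) <= k + 2 * b)%N.
  have := Glip n (b ^ 2 - n)%N; rewrite subnKC // => /leq_trans; apply.
  by apply: leq_add; [exact: Gle | rewrite leq_subLR].
rewrite -(ler_nat R) => /le_trans; apply.
rewrite natrD /k -natr1.
have nbR : n%:R <= (b ^ 2)%:R :> R by rewrite ler_nat.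
have b1 : 1 <= b%:R :> R by rewrite ler1n (leq_trans M0).
move: kle nbR; rewrite -!natr1 natrM natrX expr2 => kle nbR.
set T := (Num.truncn _)%:R in kle *.
nra.
Qed.

(** * Null measure under a power bound on the gauge *)

Lemma hausdorff_Dim_le_eq0 (R : realType) (U : pcode) (f : R -> R) (s r : R) :
  prefix_free_machine U -> (forall x, 0 < x -> 0 < f x) -> s < r ->
  ev_le f (fun x => x `^ r) -> (hausdorff f (Dim_le U s) <= 0)%E.
Proof.
move=> pfU fpos sr [d d0 fle]; apply: ge_ereal_sup => _ [n _ <-].
apply/lee_addgt0Pr => e e0; rewrite add0e.
have p2 k : 0 < (2%:R : R) ^- k by rewrite invr_gt0 exprn_gt0.
pose q := (s + r) / 2.
have [sq qr] : s < q /\ q < r by rewrite /q; split; lra.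
have [k kd] := exists_expV2_lt R d d0; have [m me] := exists_expV2_lt R e e0.
(* For strings of length at least [N], the cover is fine enough, the bound on [f] applies, and the
   gap [(r - q) |sigma| >= m] gives [2^-(r |sigma|) <= 2^-m 2^-|p|]. *)
pose N := maxn n (maxn k (Num.bound (m%:R / (r - q)))).
have Nm : m%:R <= (r - q) * N%:R.
  rewrite -ler_pdivrMl ?subr_gt0 // mulrC; apply: le_trans (ltW (unstable.ltr_bound _)) _.
  by rewrite ler_nat /N !leq_max leqnn !orbT.
have [T [Tex TP Tle]] := halting_family R U
  (fun p sigma => (N <= size sigma)%N /\ (size p)%:R <= q * (size sigma)%:R) pfU.
apply: le_trans (Tle (fun t => f (2%:R ^- size t)) e _ (ltW e0) _); last first.
- move=> p sigma _ [Ns szp].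
  apply: le_trans (fle _ _) _.
    rewrite p2; apply: le_lt_trans kd; rewrite lef_pV2 ?posrE ?exprn_gt0 //.
    by apply: ler_weXn2l; rewrite ?ler1n // (leq_trans _ Ns) // /N !leq_max leqnn !orbT.
  apply: le_trans (_ : _ <= 2%:R ^- m * 2%:R ^- size p) _; last by rewrite ler_pM2r // ltW.
  rewrite -!powR_invn // -powRrM -powRD ?pnatr_eq0 ?implybT // ler_powR ?ler1n //.
  have : N%:R <= (size sigma)%:R :> R by rewrite ler_nat.
  by nra.
- by move=> t; exact: ltW (fpos _ (p2 _)).
apply: ereal_inf_lbound; exists T => //; split.
  by move=> i t /TP[p _ [Nt _]]; apply: leq_trans Nt; rewrite /N leq_max leqnn.
move=> x /= dimx.
have dimq : (eff_dim U x < q%:E)%E by apply: le_lt_trans dimx _; rewrite lte_fin.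
have [l [p [Nl Up szp]]] := eff_dim_lt R U x q dimq N.
have [|i Ti] := Tex p (restr x l) Up; first by rewrite size_mkseq.
by exists i => //; rewrite Ti; apply/cyl_restr; rewrite size_mkseq.
Qed.

(** * Positive measure: the envelope and its mass distribution *)

(** Recursive choice with [r = s + 1/(k+1)], denominators cleared. The second clause makes [b k ^ 2]
    negligible against [b k.+1 ^ 2]. *)
Lemma sparse_squares (R : realType) (s : R) (G : nat -> nat) :
  (forall r, s < r -> forall N, exists2 b, (N <= b)%N & (G (b ^ 2)%N)%:R <= r * (b ^ 2)%:R) ->
  exists b : nat -> nat, forall k, [/\ (k.+1 <= b k.+1)%N, (k.+1 * b k ^ 2 <= b k.+1)%N &
    k.+1%:R * (G (b k.+1 ^ 2)%N)%:R <= (k.+1%:R * s + 1) * (b k.+1 ^ 2)%:R].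
Proof.
move=> H.
have /choice[h hP] : forall kN : nat * nat, exists b, (kN.2 <= b)%N /\
    kN.1.+1%:R * (G (b ^ 2)%N)%:R <= (kN.1.+1%:R * s + 1) * (b ^ 2)%:R.
  move=> [k N] /=; have [|b Nb Gb] := H (s + k.+1%:R^-1) _ N; first by rewrite ltrDl invr_gt0.
  exists b; split=> //; apply: le_trans (ler_wpM2l _ Gb) _ => //.
  by rewrite mulrA mulrDr divff.
pose b := fix b k := if k is k'.+1 then h (k', k'.+1 + k'.+1 * b k' ^ 2)%N else 0%N.
exists b => k.
have [/= le ?] := hP (k, k.+1 + k.+1 * b k ^ 2)%N; split=> //.
  by apply: leq_trans le; rewrite leq_addr.
by apply: leq_trans le; rewrite leq_addl.
Qed.

(* [F] is the largest function with increments in {0, 1} that agrees with [G]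
   on the sequence [m]: after each [m k] it grows at full speed until it reaches
   the next prescribed value. *)
Lemma lipschitz_envelope (G m : nat -> nat) :
  (forall n, (G n <= G n.+1 <= (G n).+1)%N) -> {homo m : i j / (i <= j)%N} ->
  exists F : nat -> nat, [/\ forall n, (F n <= F n.+1 <= (F n).+1)%N,
    forall n, (G n <= F n)%N &
    forall k j, (m k + G (m k.+1) <= j <= m k.+1)%N -> F j = G (m k.+1)].
Proof.
move=> GS mm.
have Gm : {homo G : i j / (i <= j)%N} by apply: homo_leq => // [i|i]; [exact: leq_trans | case/andP: (GS i)].
have Glip i j : (G j <= G i + (j - i))%N.
  have [ji|/ltnW/subnK<-] := leqP j i; first by rewrite (leq_trans (Gm _ _ ji)) ?leq_addr.
  rewrite addnK; elim: (j - i)%N => [|d IH]; first by rewrite addn0.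
  by rewrite addSn addnS; case/andP: (GS (d + i)%N) => _ /leq_trans; apply.
have exF n : exists v, `[< exists k, v = (G (m k) + (n - m k))%N >].
  by exists (G (m 0%N) + (n - m 0%N))%N; apply/asboolP; exists 0%N.
pose F n := ex_minn (exF n).
have Fex n : exists k, F n = (G (m k) + (n - m k))%N.
  by rewrite /F; case: ex_minnP => v /asboolP.
have Fle n k : (F n <= G (m k) + (n - m k))%N.
  by rewrite /F; case: ex_minnP => v _; apply; apply/asboolP; exists k.
exists F; split=> [n|n|k j /andP[kj jk]].
- have [k Fk] := Fex n; have [k' Fk'] := Fex n.+1.
  by have := Fle n k'; have := Fle n.+1 k; lia.
- by have [k ->] := Fex n; exact: Glip.
- apply/eqP; rewrite eqn_leq; apply/andP; split.
    by apply: leq_trans (Fle j k.+1) _; lia.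
  (* An index [k' <= k] contributes at least [j - m k >= G (m k.+1)]; for a later one, monotonicity
     of [G] suffices. *)
  have [k' ->] := Fex j; have [k'k|kk'] := leqP k' k; first by have := mm _ _ k'k; lia.
  by apply: leq_trans (Gm _ _ (mm _ _ kk')) _; rewrite leq_addr.
Qed.

Definition free_bits (F : nat -> nat) (sigma : seq bool) : bool :=
  all (fun j => nth false sigma j ==> (F j < F j.+1)%N) (iota 0 (size sigma)).

(** When [F] has increments 0 or 1, there are [F n - F 0] free positions below [n], so this is the
    uniform distribution with total mass [2^-(F 0)]. *)
Definition envelope_mass (R : realType) (F : nat -> nat) (sigma : seq bool) : R :=
  if free_bits F sigma then 2%:R ^- F (size sigma) else 0.

Lemma free_bits_rcons (F : nat -> nat) (sigma : seq bool) (b : bool) :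
  free_bits F (rcons sigma b) =
  free_bits F sigma && (b ==> (F (size sigma) < F (size sigma).+1)%N).
Proof.
rewrite /free_bits size_rcons -[(size sigma).+1]addn1 iotaD all_cat /= andbT add0n.
rewrite nth_rcons ltnn eqxx addn1; congr (_ && _); apply: eq_in_all => j.
by rewrite mem_iota nth_rcons => /andP[_ ->].
Qed.

Lemma is_mass_envelope (R : realType) (F : nat -> nat) :
  (forall n, (F n <= F n.+1 <= (F n).+1)%N) -> is_mass R (envelope_mass R F).
Proof.
move=> FS; split=> sigma; rewrite /envelope_mass; first by case: ifP; rewrite ?invr_ge0 ?exprn_ge0.
rewrite !free_bits_rcons !size_rcons /= andbT; case: (free_bits F sigma) => /=; last by rewrite addr0.
have := FS (size sigma); case: ltnP => [lt /andP[_ le]|le /andP[ge _]].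
  rewrite (_ : F (size sigma).+1 = (F (size sigma)).+1); last by apply/eqP; rewrite eqn_leq le.
  by rewrite exprS invfM; lra.
by rewrite addr0; congr (2%:R ^- _); apply/eqP; rewrite eqn_leq le.
Qed.

Lemma envelope_mass_gt0_nonfree (R : realType) (F : nat -> nat) (x : cantor) (j : nat) :
  0 < envelope_mass R F (restr x j.+1) -> F j.+1 = F j -> x j = false.
Proof.
rewrite /envelope_mass; case: ifP => [/allP/(_ j)|_]; last by rewrite ltxx.
rewrite mem_iota size_mkseq ltnSn nth_mkseq // => /(_ isT) + _ E.
by rewrite E ltnn; case: (x j).
Qed.

Lemma hausdorff_Dim_eq_gt0 (R : realType) (U : pcode) (f : R -> R) (s : R) :
  optimal_pf_machine U -> gauge f ->
  {in `]0, +oo[ &, forall x y, x <= y -> y^-1 * f y <= x^-1 * f x} ->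
  0 <= s -> s < 1 -> (forall r : R, s < r <= 1 -> ~ ev_le f (fun x => x `^ r)) ->
  (0 < hausdorff f (Dim_eq U s))%E.
Proof.
move=> HU fg fdec s0 s1 nle; have [_ [_ [fpos _]]] := fg.
have p2 k : 0 < (2%:R : R) ^- k by rewrite invr_gt0 exprn_gt0.
have [G [GS Gf Gs Gsmall]] := gauge_exponent R f s fg fdec s0 s1 nle.
have [b bP] := sparse_squares R s G Gsmall.
have bS k : (b k <= b k.+1)%N.
  have [_ + _] := bP k; apply: leq_trans.
  by case: (b k) => // m; rewrite mulSn -mulnn; nia.
have bm : {homo b : i j / (i <= j)%N} by apply: homo_leq bS => // ? ? ?; exact: leq_trans.
have b2m : {homo (fun k => b k ^ 2)%N : i j / (i <= j)%N}.
  by move=> i j /bm; rewrite leq_exp2r.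
have [F [FS GF Fconst]] := lipschitz_envelope G (fun k => b k ^ 2)%N GS b2m.
pose mu := envelope_mass R F.
have mass : is_mass R mu := is_mass_envelope R F FS.
have mule t : mu t <= 2%:R ^- F (size t).
  by rewrite /mu /envelope_mass; case: ifP => // _; exact: ltW.
have muf t : mu t <= f (2%:R ^- size t).
  apply: le_trans (mule t) _; apply: le_trans (Gf _).
  by rewrite lef_pV2 ?posrE ?exprn_gt0 // ler_weXn2l ?ler1n.
(* The constant [(F 0).+1] keeps the mass of these compressible strings within half of the total
   mass [2^-(F 0)]; the other half bounds the cost of a cover from below. *)
have [T [Tex _ Tle]] := halting_family R U
  (fun p sigma => (size p + (F 0%N).+1 <= F (size sigma))%N) (proj1 HU).
have Tmass : (family_mass R mu T <= (2%:R ^- (F 0%N).+1)%:E)%E.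
  apply: Tle => [t||p sigma _ le]; [exact: (proj1 mass) | exact: ltW |].
  apply: le_trans (mule sigma) _.
  rewrite -invfM -exprD lef_pV2 ?posrE ?exprn_gt0 //.
  by rewrite ler_weXn2l ?ler1n // addnC.
apply: (@lt_le_trans _ _ (2%:R ^- (F 0%N).+1)%:E); first by rewrite lte_fin.
(* [hausdorff] is a supremum over the length bound, so covers by strings of any length suffice. *)
apply: le_ereal_sup_tmp; exists (ereal_inf [set cover_cost f sig | sig in covers (Dim_eq U s) 0]).
  by exists 0%N.
apply: le_ereal_inf_tmp => _ [sig [_ sigcov] <-]; rewrite leNgt; apply/negP => cost.
have [|x [xmu xsig xT]] := escape R mu sig T mass.
  have -> : mu [::] = 2%:R ^- (F 0%N).+1 + 2%:R ^- (F 0%N).+1.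
    by rewrite /mu /envelope_mass /= exprS invfM; lra.
  have mu0 := proj1 mass.
  rewrite EFinD; apply: lte_leD => //.
    by rewrite ge0_fin_numE ?family_mass_ge0 // (le_lt_trans Tmass) // ltry.
  by apply: (@le_lt_trans _ _ (cover_cost f sig)) cost; exact: le_family_mass.
suff /sigcov[i _] : Dim_eq U s x.
  by case E : (sig i) => [t|] // xt; exact: (xsig _ _ E xt).
rewrite /Dim_eq /=; apply/eqP; rewrite eq_le; apply/andP; split; last first.
  apply: (eff_dim_ge R U x s (F 0%N).+1) => n p Up.
  apply: le_trans (Gs n) _; rewrite ler_nat; apply: leq_trans (GF n) _.
  rewrite leqNgt; apply/negP => lt.
  have [|i Ti] := Tex p _ Up; first by rewrite size_mkseq ltnW.
  by apply: (xT _ _ Ti); apply/cyl_restr; rewrite size_mkseq.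
apply: eff_dim_le => r sr N.
have [c Uc] := optimal_zero_pad U HU.
(* In units of [B ^ 2 / (k+1)], the errors are 2 from [len], 4 from the term [4 * B] and [c] from
   the machine constant. The bound with [1 - s] ensures [m + G (B ^ 2) <= B ^ 2]. *)
pose k := maxn N (maxn (Num.bound ((6 + c)%:R / (r - s))) (Num.bound (2%:R / (1 - s)))).
have kr : (6 + c)%:R <= (r - s) * k.+1%:R.
  rewrite -ler_pdivrMl ?subr_gt0 // mulrC; apply: le_trans (ltW (unstable.ltr_bound _)) _.
  by rewrite ler_nat leqW // /k !leq_max leqnn !orbT.
have ks : 2%:R <= (1 - s) * k.+1%:R.
  rewrite -ler_pdivrMl ?subr_gt0 // mulrC; apply: le_trans (ltW (unstable.ltr_bound _)) _.
  by rewrite ler_nat leqW // /k !leq_max leqnn !orbT.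
have [kb bb Gb] := bP k; have {Fconst} Fconst := Fconst k.
have Nb : (N <= b k.+1)%N by apply: leq_trans kb; rewrite leqW // /k leq_max leqnn.
move: (b k.+1) kb bb Gb Fconst Nb => B kb bb Gb Fconst Nb.
move: (b k ^ 2)%N bb Fconst => m bb Fconst.
have B0 : (0 < B)%N by apply: leq_trans kb.
have BB : (B <= B ^ 2)%N by rewrite -mulnn leq_pmulr.
have K0 : 0 < k.+1%:R :> R by rewrite ltr0n.
have BBR : B%:R <= (B ^ 2)%:R :> R by rewrite ler_nat.
have len : k.+1%:R * (m + G (B ^ 2))%N%:R <= (k.+1%:R * s + 2%:R) * (B ^ 2)%:R.
  have : k.+1%:R * m%:R <= B%:R :> R by rewrite -natrM ler_nat.
  by rewrite natrD; lra.
have lenB : (m + G (B ^ 2) <= B ^ 2)%N.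
  rewrite -(ler_nat R) -(ler_pM2l K0); apply: le_trans len _.
  by rewrite ler_wpM2r //; lra.
(* [F] is constant between [m + G (B ^ 2)] and [B ^ 2], so [x] vanishes there; the machine wants the
   initial part to have square length, hence the rounding. *)
have [a [la al amin]] := square_ceil (m + G (B ^ 2))%N.
have aB : (a <= B)%N := amin _ lenB.
have [p Up szp] := Uc a B (restr x (a ^ 2)%N) (size_mkseq _ _) aB.
have restrE : restr x (a ^ 2)%N ++ nseq (B ^ 2 - a ^ 2)%N false = restr x (B ^ 2)%N.
  have a2 : (a ^ 2 <= B ^ 2)%N by rewrite leq_exp2r.
  apply: (@eq_from_nth _ false); rewrite size_cat size_nseq !size_mkseq subnKC // => j jB.
  rewrite nth_cat size_mkseq nth_nseq [RHS]nth_mkseq //.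
  case: ltnP => ja; first by rewrite nth_mkseq.
  rewrite (envelope_mass_gt0_nonfree R F x j (xmu _)) ?if_same //.
  by rewrite !Fconst //; apply/andP; split; rewrite ?jB ?(ltnW jB) ?leqW // (leq_trans la).
exists (B ^ 2)%N, p; split; [exact: leq_trans Nb BB|by rewrite expn_gt0 B0|by rewrite -restrE|].
(* Rounding costs [2 * a], the unary blocks [a + B], and [a <= B]. *)
have szp' : (size p <= m + G (B ^ 2) + 4 * B + c)%N by lia.
rewrite -(ler_pM2l K0); apply: le_trans (_ : _ <= k.+1%:R * (m + G (B ^ 2) + 4 * B + c)%N%:R) _.
  by rewrite ler_pM2l // ler_nat.
have KB : k.+1%:R * B%:R <= (B ^ 2)%:R :> R by rewrite -natrM ler_nat -mulnn leq_mul.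
have Kc : k.+1%:R * c%:R <= c%:R * (B ^ 2)%:R :> R.
  by rewrite mulrC ler_wpM2l // (le_trans _ BBR) // ler_nat.
apply: le_trans (_ : _ <= (k.+1%:R * s + (6 + c)%:R) * (B ^ 2)%:R) _.
  by move: len; rewrite !(natrD _ _ c) !(natrD _ _ (4 * B)%N) natrM; lra.
by rewrite mulrA ler_wpM2r //; lra.
Qed.

Theorem theorem2 (R : realType) (U : pcode) (HU : optimal_pf_machine U)
  (f : R -> R) (Hf : gauge f)
  (Hdec : {in `]0, +oo[ &, forall x y, x <= y -> y^-1 * f y <= x^-1 * f x})
  (s : R) (hs0 : 0 <= s) (hs1 : s < 1) :
  ((0 < hausdorff f (Dim_eq U s))%E <-> (0 < hausdorff f (Dim_le U s))%E) /\
  ((0 < hausdorff f (Dim_le U s))%E <->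
     (forall r : R, s < r <= 1 -> ~ ev_le f (fun x => x `^ r))).
Proof.
have H12 : (0 < hausdorff f (Dim_eq U s))%E -> (0 < hausdorff f (Dim_le U s))%E.
  move=> /lt_le_trans; apply; apply: ge_ereal_sup => _ [n _ <-].
  apply: le_ereal_sup_tmp; exists (ereal_inf [set cover_cost f sig | sig in covers (Dim_le U s) n]).
    by exists n.
  apply: ereal_inf_le_tmp => _ [sig [szsig cov] <-]; exists sig => //; split=> // x xs.
  by apply: cov; rewrite /Dim_le /= xs.
have H23 : (0 < hausdorff f (Dim_le U s))%E ->
    forall r : R, s < r <= 1 -> ~ ev_le f (fun x => x `^ r).
  move=> pos r /andP[sr _] fr; have [_ [_ [fpos _]]] := Hf.
  have := hausdorff_Dim_le_eq0 R U f s r (proj1 HU) fpos sr fr.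
  by rewrite leNgt pos.
have H31 := hausdorff_Dim_eq_gt0 R U f s HU Hf Hdec hs0 hs1.
by split; split; [exact: H12 | move=> /H23/H31 | exact: H23 | move=> /H31/H12].
Qed.
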